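(* (Graded-Unitary Spin-Statistics.) Let $(\mathcal V,(-,-),\mathfrak R_\bullet,\rho)$ be a weak graded-unitary vertex algebra. Then the Grassmann parity $|x|$ of any nonzero (parity-homogeneous) element $x\in\mathcal V_{h,R}$ satisfies $$(-1)^{|x|}=(-1)^{2(h+R)}.$$
   Context: Vertex algebras are over $\mathbb C$ and may have Grassmann-odd elements; $|x|\in\{0,1\}$ is Grassmann parity (no relation to half-integrality of conformal weight is imposed), $Y(x,z)=\sum_{n\in\mathbb Z}x_nz^{-n-1}$, $\partial$ is translation. A Möbius vertex algebra is a $\frac12\mathbb Z$-graded vertex algebra $\mathcal V=\bigoplus_h\mathcal V_h$, $\dim\mathcal V_h<\infty$, $\mathcal V_h=0$ for $h\ll0$, with endomorphisms $L_{\pm1},L_0$ satisfying $[L_m,L_n]=(m-n)L_{m+n}$, $L_m|0\rangle=0$, $L_{-1}=\partial$, $L_0|_{\mathcal V_h}=h$, $[L_m,Y(x,z)]=\sum_{n=0}^{m+1}\binom{m+1}{n}z^{m+1-n}Y(L_{n-1}x,z)$. A bilinear form $(-,-)$ is invariant if $(Y(x,z)u,v)=(-1)^{|x||u|}(u,Y(e^{zL_1}(e^{\mathrm i\pi}z^{-2})^{L_0}x,z^{-1})v)$ and $(L_mu,v)=(u,L_{-m}v)$ for $m\in\{-1,0,1\}$; such a form satisfies $(x,y)=(-1)^{|x||y|+2h}(y,x)$ for homogeneous $x,y\in\mathcal V_h$. A half-integral filtration of a $\mathbb Z_2$-graded vertex algebra $\mathcal V=\mathcal V^0\oplus\mathcal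 V^{1/2}$ is an increasing exhaustive filtration by $\mathfrak R_p\mathcal V$, $p\in\frac12\mathbb Z$ ($\mathfrak R_p\mathcal V\subseteq\mathcal V^0$ if $p\in\mathbb Z$, $\subseteq\mathcal V^{1/2}$ if $p\in\frac12+\mathbb Z$; increasing in integer steps), with $|0\rangle\in\mathfrak R_0\mathcal V$ and $x_ny\in\mathfrak R_{p+q}\mathcal V$ for $x\in\mathfrak R_p\mathcal V$, $y\in\mathfrak R_q\mathcal V$, $n\in\mathbb Z$. It is nondegenerate if $(-,-)$ restricts nondegenerately to every filtered component. Filtrations are understood to be separated and compatible with conformal weight, so that imposing orthogonality refines a nondegenerate filtration to a grading $\mathcal V=\bigoplus_{h,R}\mathcal V_{h,R}$, with $\mathfrak R_p\mathcal V=\bigoplus_{R\le p,\ R\equiv p\ {\rm mod}\ \mathbb Z}\mathcal V_{\bullet,R}$. Set $\sigma|_{\mathcal V_{h,R}}=\mathrm i^{2R}$, $s=\sigma^2$. A weak graded-unitary vertex algebra is $(\mathcal V,(-,-),\mathfrak R_\bullet,\rho)$ with $\mathcal V$ a $\mathbb Z_2$-graded Möbius vertex algebra, $(-,-)$ a nondegenerate invariant bilinear form, $\mathfrak R_\bullet$ a nondegenerate half-integral filtration, and $\rho$ a quaternionic structure: an anti-linear isomorphism with $\rho(|0\rangle)=|0\rangle$, commuting with $L_{\pm1},L_0$, $\rho(x_ny)=(-1)^{|x||y|}\rho(x)_n\rho(y)$ (in particular parity-preserving), $\rho(\mathfrak R_p\mathcal V)\subseteq\mathfrak R_p\mathcal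 V$, $\rho^2=s$, $\rho\sigma=\sigma^{-1}\rho$ (so $\rho$ preserves each $\mathcal V_{h,R}$); such that the Hermitian form $\langle x|y\rangle:=((\sigma\circ\rho)(x),y)$ is positive-definite. *)

(* Defs.v *)
From HB Require Import structures.
From mathcomp Require Import all_boot all_order all_algebra.
From mathcomp Require Import all_classical all_reals.
From mathcomp Require Export complex.

Set Implicit Arguments.
Unset Strict Implicit.
Unset Printing Implicit Defensive.

Import Order.TTheory GRing.Theory Num.Theory.

Local Open Scope classical_set_scope.
Local Open Scope ring_scope.

(* The field of complex numbers is R[i] with R : realType.
   An element p of (1/2)Z is always represented by the integer 2p; this applies
   to the conformal weights h and to the filtration degrees p and R.  For
   instance e^{i pi h} is ['i ^ h2], i^{2R} is ['i ^ r2] and (-1)^{2(h+R)} is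
   [(-1) ^ (h2 + r2)], where h2 = 2h and r2 = 2R. *)

Section LinearAlgebra.
Variables (R : realType) (V : lmodType R[i]).

Definition is_subspace (W : set V) : Prop :=
  W 0 /\ forall (a : R[i]) (u v : V), W u -> W v -> W (a *: u + v).

(* W is the sum of the subspaces U i. *)
Definition spanned_by (I : Type) (W : set V) (U : I -> set V) : Prop :=
  forall v, W v ->
    exists (s : seq I) (f : I -> V), (forall i, U i (f i)) /\ v = \sum_(i <- s) f i.

Definition independent (I : eqType) (U : I -> set V) : Prop :=
  forall (s : seq I) (f : I -> V), uniq s -> (forall i, U i (f i)) ->
    \sum_(i <- s) f i = 0 -> forall i, i \in s -> f i = 0.

(* V is the internal direct sum of the subspaces U i. *)
Definition is_direct_sum (I : eqType) (U : I -> set V) : Prop :=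
  [/\ forall i, is_subspace (U i), spanned_by setT U & independent U].

Definition finite_dimensional (W : set V) : Prop :=
  exists s : seq V, forall v, W v ->
    exists c : 'I_(size s) -> R[i], v = \sum_i c i *: s`_i.

Definition bilinear_form (B : V -> V -> R[i]) : Prop :=
  (forall v, scalar (fun u => B u v)) /\ (forall u, scalar (B u)).

Definition nondegenerate_on (W : set V) (B : V -> V -> R[i]) : Prop :=
  (forall u, W u -> (forall v, W v -> B u v = 0) -> u = 0) /\
  (forall v, W v -> (forall u, W u -> B u v = 0) -> v = 0).

Definition antilinear (f : V -> V) : Prop :=
  forall (a : R[i]) (u v : V), f (a *: u + v) = a^* *: f u + f v.

(* Positivity [0 < H x x] in R[i] means that H x x is real and positive. *)
Definition positive_definite_hermitian (H : V -> V -> R[i]) : Prop :=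
  [/\ forall v (a : R[i]) u u', H (a *: u + u') v = a^* * H u v + H u' v,
      forall u, scalar (H u),
      forall u v, H v u = (H u v)^* &
      forall x, x != 0 -> 0 < H x x].

End LinearAlgebra.

(* [va_parity A e] is the subspace of elements x with |x| = e (true for odd)
   and [va_mode A x n u] is x_n u. *)
Record vertex_algebra (R : realType) (V : lmodType R[i]) := VertexAlgebra {
  va_parity : bool -> set V;
  va_vacuum : V;
  va_transl : {linear V -> V};
  va_mode : V -> int -> V -> V;
  va_parity_sum : is_direct_sum va_parity;
  va_mode_linearl : forall n u, linear (fun x => va_mode x n u);
  va_mode_linearr : forall x n, linear (va_mode x n);
  va_vacuum_even : va_parity false va_vacuum;
  va_mode_parity : forall e e' x n u,
    va_parity e x -> va_parity e' u -> va_parity (e (+) e') (va_mode x n u);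
  va_field : forall x u, exists N : int, forall n : int, N <= n -> va_mode x n u = 0;
  va_vacuum_mode : forall (n : int) u, va_mode va_vacuum n u = if n == -1 then u else 0;
  va_creation : forall x, va_mode x (-1) va_vacuum = x;
  va_creation_ge0 : forall x (n : int), 0 <= n -> va_mode x n va_vacuum = 0;
  va_transl_vacuum : va_transl va_vacuum = 0;
  va_transl_mode : forall x (n : int) u,
    va_transl (va_mode x n u) - va_mode x n (va_transl u) =
    - (n%:~R *: va_mode x (n - 1) u);
  (* (z - w)^N [Y(x,z), Y(y,w)] = 0, with the supercommutator, coefficientwise *)
  va_locality : forall e e' x y, va_parity e x -> va_parity e' y ->
    exists N : nat, forall (m n : int) u,
      \sum_(j < N.+1) ((-1) ^+ j * 'C(N, j)%:R) *:
        (va_mode x (m + N%:Z - j%:Z) (va_mode y (n + j%:Z) u)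
         - (-1) ^+ (e && e') *:
             va_mode y (n + j%:Z) (va_mode x (m + N%:Z - j%:Z) u)) = 0
}.

(* Only L_{-1}, L_0 and L_1 are meaningful: the values [mva_L m] at the other
   integers m are unconstrained. *)
Record moebius_vertex_algebra (R : realType) (V : lmodType R[i]) :=
  MoebiusVertexAlgebra {
  mva_va :> vertex_algebra V;
  mva_weight : int -> set V;
  mva_L : int -> {linear V -> V};
  mva_weight_sum : is_direct_sum mva_weight;
  mva_weight_fin : forall h, finite_dimensional (mva_weight h);
  mva_weight_bounded : exists h0 : int, forall h : int, h < h0 -> mva_weight h = [set 0];
  mva_weight_vacuum : mva_weight 0 (va_vacuum mva_va);
  mva_weight_mode : forall (h h' : int) x (n : int) u, mva_weight h x -> mva_weight h' u ->
    mva_weight (h + h' - 2 * (n + 1)) (va_mode mva_va x n u);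
  mva_L_even : forall (m : int) e x, -1 <= m <= 1 ->
    va_parity mva_va e x -> va_parity mva_va e (mva_L m x);
  mva_L_comm : forall (m n : int) x, -1 <= m <= 1 -> -1 <= n <= 1 ->
    mva_L m (mva_L n x) - mva_L n (mva_L m x) = (m - n)%:~R *: mva_L (m + n) x;
  mva_L_vacuum : forall m : int, -1 <= m <= 1 -> mva_L m (va_vacuum mva_va) = 0;
  mva_L_transl : forall x, mva_L (-1) x = va_transl mva_va x;
  mva_L_weight : forall h x, mva_weight h x -> mva_L 0 x = (h%:~R / 2) *: x;
  (* the coefficient of z^{-k-1} in the formula for [L_m, Y(x,z)] *)
  mva_L_mode : forall (m : int) x (k : int) u, -1 <= m <= 1 ->
    mva_L m (va_mode mva_va x k u) - va_mode mva_va x k (mva_L m u) =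
    \sum_(j < (absz (m + 1)%R).+1) 'C(absz (m + 1)%R, j)%:R *:
       va_mode mva_va (mva_L (j%:Z - 1) x) (k + m + 1 - j%:Z) u
}.

Section InvariantForm.
Variables (R : realType) (V : lmodType R[i]) (A : moebius_vertex_algebra V).

(* For x of conformal weight h and N such that L_1^N x = 0, this is the
   coefficient of z^{-n-1} in Y(e^{z L_1} (e^{i pi} z^{-2})^{L_0} x, z^{-1}) v:
   since (e^{i pi} z^{-2})^{L_0} x = e^{i pi h} z^{-2h} x, the series is
   e^{i pi h} \sum_k \sum_m z^{k - 2h + m + 1} / k! (L_1^k x)_m v, and the
   required coefficient comes from m = 2h - n - k - 2. *)
Definition adjoint_mode (h : int) (N : nat) (x : V) (n : int) (v : V) : V :=
  'i ^ h *: \sum_(k < N)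
    (k`!%:R)^-1 *: va_mode A (iter k (mva_L A 1) x) (h - n - k%:Z - 2) v.

Definition invariant_form (B : V -> V -> R[i]) : Prop :=
  (forall (h : int) e e' x u v (n : int) (N : nat), mva_weight A h x ->
     va_parity A e x -> va_parity A e' u -> iter N (mva_L A 1) x = 0 ->
     B (va_mode A x n u) v = (-1) ^+ (e && e') * B u (adjoint_mode h N x n v)) /\
  (forall (m : int) u v, -1 <= m <= 1 -> B (mva_L A m u) v = B u (mva_L A (- m) v)).

(* [S false] and [S true] are V^0 and V^{1/2}. *)
Definition z2_grading (S : bool -> set V) : Prop :=
  [/\ is_direct_sum S,
      S false (va_vacuum A),
      forall b b' x n u, S b x -> S b' u -> S (b (+) b') (va_mode A x n u) &
      forall (m : int) b x, -1 <= m <= 1 -> S b x -> S b (mva_L A m x)].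

(* The class in (1/2)Z / Z of the half-integer represented by p. *)
Definition half_integral (p : int) : bool := odd (absz p).

Record half_integral_filtration (S : bool -> set V) (F : int -> set V) : Prop :=
  HalfIntegralFiltration {
  hif_subspace : forall p : int, is_subspace (F p);
  hif_sector : forall p, F p `<=` S (half_integral p);
  hif_increasing : forall p, F p `<=` F (p + 2);
  hif_exhaustive : forall b, S b `<=` \bigcup_(p in [set p | half_integral p = b]) F p;
  hif_vacuum : F 0 (va_vacuum A);
  hif_mode : forall p q x n u, F p x -> F q u -> F (p + q) (va_mode A x n u);
  hif_separated : forall b, \bigcap_(p in [set p | half_integral p = b]) F p = [set 0];
  (* F p is the sum of its intersections with the weight spaces *)
  hif_weight : forall p, spanned_by (F p) (fun h => F p `&` mva_weight A h)
}.

(* V_{h,R}: the orthogonal of F_{R-1} in the part of conformal weight h of F_R. *)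
Definition bigraded (B : V -> V -> R[i]) (F : int -> set V) (h r : int) : set V :=
  [set x | [/\ mva_weight A h x, F r x & forall y, F (r - 2) y -> B x y = 0]].

End InvariantForm.

(* The V_{h,R} span V, so [wgu_sigma] is the operator determined by
   [wgu_sigma_bigraded], and [wgu_sigmaV] is its inverse. *)
Record weak_graded_unitary (R : realType) (V : lmodType R[i]) :=
  WeakGradedUnitary {
  wgu_mva :> moebius_vertex_algebra V;
  wgu_sector : bool -> set V;
  wgu_form : V -> V -> R[i];
  wgu_filtration : int -> set V;
  wgu_sigma : {linear V -> V};
  wgu_sigmaV : V -> V;
  wgu_rho : V -> V;
  wgu_z2 : z2_grading wgu_mva wgu_sector;
  wgu_form_bilinear : bilinear_form wgu_form;
  wgu_form_nondegenerate : nondegenerate_on setT wgu_form;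
  wgu_form_invariant : invariant_form wgu_mva wgu_form;
  wgu_filtrationP : half_integral_filtration wgu_mva wgu_sector wgu_filtration;
  wgu_filtration_nondegenerate :
    forall p, nondegenerate_on (wgu_filtration p) wgu_form;
  wgu_sigma_bigraded : forall h r x,
    bigraded wgu_mva wgu_form wgu_filtration h r x -> wgu_sigma x = 'i ^ r *: x;
  wgu_sigmaK : cancel wgu_sigma wgu_sigmaV;
  wgu_sigmaVK : cancel wgu_sigmaV wgu_sigma;
  wgu_rho_antilinear : antilinear wgu_rho;
  wgu_rho_bijective : bijective wgu_rho;
  wgu_rho_vacuum : wgu_rho (va_vacuum wgu_mva) = va_vacuum wgu_mva;
  wgu_rho_L : forall (m : int) x, -1 <= m <= 1 ->
    wgu_rho (mva_L wgu_mva m x) = mva_L wgu_mva m (wgu_rho x);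
  wgu_rho_parity : forall e x,
    va_parity wgu_mva e x -> va_parity wgu_mva e (wgu_rho x);
  wgu_rho_mode : forall e e' x n y,
    va_parity wgu_mva e x -> va_parity wgu_mva e' y ->
    wgu_rho (va_mode wgu_mva x n y) =
    (-1) ^+ (e && e') *: va_mode wgu_mva (wgu_rho x) n (wgu_rho y);
  wgu_rho_filtration : forall p x,
    wgu_filtration p x -> wgu_filtration p (wgu_rho x);
  wgu_rho_square : forall x, wgu_rho (wgu_rho x) = wgu_sigma (wgu_sigma x);
  wgu_rho_sigma : forall x, wgu_rho (wgu_sigma x) = wgu_sigmaV (wgu_rho x);
  wgu_positive :
    positive_definite_hermitian (fun x y => wgu_form (wgu_sigma (wgu_rho x)) y)
}.

Definition wgu_bigraded (R : realType) (V : lmodType R[i])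
    (A : weak_graded_unitary V) (h r : int) : set V :=
  bigraded A (wgu_form A) (wgu_filtration A) h r.

(* Main.v *)
From HB Require Import structures.
Require Import Defs.
From mathcomp Require Import all_boot all_order all_algebra.
From mathcomp Require Import all_classical all_reals complex.
From mathcomp Require Import ring zify.

(** The sign in the theorem comes from comparing two positive numbers.  For
    [x] in V_{h,R} of parity [e], the relations [rho^2 = sigma^2] and
    [rho sigma = sigma^-1 rho] give [sigma (rho x) = i^{2R} rho x]
    ([sigma_rho]), so that
    - [<x|x> = i^{2R} (rho x, x)], and
    - [<rho x|rho x> = (sigma^3 x, rho x) = i^{6R} (x, rho x)].
    The bilinear form is symmetric up to the sign [(-1)^{e + 2h}] on vectors of
    parity [e] and weight [h] ([invariant_form_symmetric]), hence
    [<rho x|rho x> = (-1)^{2R + e + 2h} <x|x>].  As both norms are positive, the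
    sign is [1].

    What remains is the symmetry of an invariant form.  Write [x] and [y] as
    [x_{-1}|0>] and [y_{-1}|0>]; invariance moves the modes to the right and
    reduces everything to the functional [phi v = (|0>, v)], which annihilates
    the images of L_{-1} and of L_1 because these operators annihilate the
    vacuum.  Two facts about [phi] finish the argument.
    - Modulo the image of the translation, skew-symmetry of the vertex operators
      loses its correction terms: [phi (x_p y) = +- (-1)^{p+1} phi (y_p x)]
      ([skew_symmetry]).  It is obtained from locality: the series
      [phi (Y(x,z) Y(y,w) |0>)] and [+- phi (Y(y,w) Y(x,z) |0>)] depend on [z - w]
      only, and agree after multiplication by [(z - w)^N].
    - Moving L_1 from one argument of a mode to the other gives
      [phi ((L_1^k y)_n x) = (-1)^k phi (y_n L_1^k x)] for the mode number [n] that
      pairs two vectors of the same weight ([L1_exchange]).  The sum over [k] in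
      the adjoint mode is therefore symmetric term by term. *)

Import Order.TTheory GRing.Theory Num.Theory.
Local Open Scope ring_scope.

(** * Multiplication of two-variable series by powers of z - w *)

(** The coefficient of [z^{-m-1} w^{-n-1}] in [(z - w)^N G(z, w)], where
    [G(z, w)] is the sum of the [G m n z^{-m-1} w^{-n-1}].  The recursion on [N],
    rather than the binomial sum, makes the properties below immediate. *)
Fixpoint diffpow (K : comNzRingType) (N : nat) (G : int -> int -> K) (m n : int) : K :=
  if N is N'.+1 then diffpow K N' G (m + 1) n - diffpow K N' G m (n + 1) else G m n.
Arguments diffpow {K} N G m n.

Section Diffpow.
Context {K : comNzRingType}.
Implicit Types (G : int -> int -> K) (N : nat) (m n : int).

Lemma diffpowE N G m n :
  diffpow N G m n =
  \sum_(j < N.+1) ((-1) ^+ j * 'C(N, j)%:R) * G (m + N%:Z - j%:Z) (n + j%:Z).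
Proof.
elim: N m n => [|N IHN] m n /=.
  by rewrite big_ord1 /= bin0 expr0 !mul1r; congr (G _ _); lia.
rewrite !IHN big_ord_recl [in RHS]big_ord_recl /= bin0.
have -> : m + 1 + N%:Z - 0%:Z = m + N.+1%:Z - 0%:Z by lia.
rewrite -addrA; congr (_ + _).
under [RHS]eq_bigr => j _.
  rewrite /bump leq0n add1n binS natrD mulrDr mulrDl.
over.
rewrite big_split /=; congr (_ + _).
  rewrite big_ord_recr /= bin_small // mulr0 mul0r addr0.
  apply: eq_bigr => j _; rewrite /bump leq0n add1n.
  by congr (_ * G _ _); lia.
rewrite -sumrN; apply: eq_bigr => j _.
rewrite exprS mulN1r !mulNr; congr (- (_ * G _ _)); lia.
Qed.

Lemma diffpow_eq0r N G m n :
  (forall m' n', 0 <= n' -> G m' n' = 0) -> 0 <= n -> diffpow N G m n = 0.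
Proof.
move=> G0; elim: N m n => [|N IHN] m n n0 /=; first exact: G0.
by rewrite !IHN ?subrr //; lia.
Qed.

Lemma diffpow_eq0l N G m n :
  (forall m' n', 0 <= m' -> G m' n' = 0) -> 0 <= m -> diffpow N G m n = 0.
Proof.
move=> G0; elim: N m n => [|N IHN] m n m0 /=; first exact: G0.
by rewrite !IHN ?subrr //; lia.
Qed.

(** For a series without negative powers of [w], setting [w = 0] turns
    [(z - w)^N] into [z^N]; the next lemma sets [z = 0] instead. *)
Lemma diffpow_edger N G m :
  (forall m' n', 0 <= n' -> G m' n' = 0) ->
  diffpow N G m (-1) = G (m + N%:Z) (-1).
Proof.
move=> G0; elim: N m => [|N IHN] m /=; first by rewrite addr0.
by rewrite IHN (diffpow_eq0r _ _ _ _ G0) ?subr0 //; congr (G _ _); lia.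
Qed.

Lemma diffpow_edgel N G n :
  (forall m' n', 0 <= m' -> G m' n' = 0) ->
  diffpow N G (-1) n = (-1) ^+ N * G (-1) (n + N%:Z).
Proof.
move=> G0; elim: N n => [|N IHN] n /=; first by rewrite addr0 mul1r.
rewrite IHN (diffpow_eq0l _ _ _ _ G0) ?sub0r // exprS mulN1r mulNr.
by congr (- (_ * G _ _)); lia.
Qed.

(** Multiplication by [z - w] commutes with [d/dz + d/dw], so the kernel of
    [d/dz + d/dw] is preserved. *)
Lemma diffpow_invariant N G :
  (forall m n, m%:~R * G (m - 1) n + n%:~R * G m (n - 1) = 0) ->
  forall m n, m%:~R * diffpow N G (m - 1) n + n%:~R * diffpow N G m (n - 1) = 0.
Proof.
move=> G0; elim: N => [|N IHN] m n /=; first exact: G0.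
have := IHN m (n + 1); have := IHN (m + 1) n.
rewrite !addrK ?subrK !intrD.
set a := diffpow N G m n; set b := diffpow N G (m + 1) (n - 1).
set c := diffpow N G (m - 1) (n + 1) => E1 E2.
have -> : m%:~R * (a - c) + n%:~R * (b - a) =
  ((m%:~R + 1%:~R) * a + n%:~R * b) - (m%:~R * c + (n%:~R + 1%:~R) * a) by ring.
by rewrite E1 E2 subrr.
Qed.
End Diffpow.

(** In total degree [k], the part without negative powers of a series killed by
    [d/dz + d/dw] is a multiple of [(z - w)^k]; the two ends of the diagonal carry the coefficients of
    [z^k] and [w^k] in [(z - w)^k]. *)
Lemma translation_invariant_diagonal {K : numDomainType} (G : int -> int -> K) (k : nat) :
  (forall m n, m%:~R * G (m - 1) n + n%:~R * G m (n - 1) = 0) ->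
  G (-1 - k%:Z) (-1) = (-1) ^+ k * G (-1) (-1 - k%:Z).
Proof.
move=> G0.
(* Walking along the diagonal produces the binomial coefficients one by one. *)
have walk (i : nat) : (i <= k)%N ->
    G (-1 - i%:Z) (-1 - k%:Z + i%:Z) = (-1) ^+ i * 'C(k, i)%:R * G (-1) (-1 - k%:Z).
  elim: i => [|i IHi] ik; first by rewrite subr0 addr0 bin0 !mul1r.
  have i1 : (i.+1%:R : K) != 0 by rewrite pnatr_eq0.
  apply: (mulfI i1).
  have := G0 (-1 - i%:Z) (- k%:Z + i%:Z).
  have -> : -1 - i%:Z - 1 = -1 - i.+1%:Z by lia.
  have -> : - k%:Z + i%:Z - 1 = -1 - k%:Z + i%:Z by lia.
  have -> : - k%:Z + i%:Z = -1 - k%:Z + i.+1%:Z by lia.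
  rewrite IHi; last lia.
  have := mul_bin_left k i; move/(congr1 (fun n : nat => n%:R : K)).
  rewrite !natrM natrB; last lia.
  set X := G _ _; set Y := G _ _ => E1 E2.
  move: E2.
  have -> : (-1 - i%:Z)%:~R = - i.+1%:R :> K.
    by rewrite -[i.+1%:R]/(i.+1%:~R) -intrN; congr (_%:~R); lia.
  have -> : (-1 - k%:Z + i.+1%:Z)%:~R = - (k%:R - i%:R) :> K.
    by rewrite -[k%:R]/(k%:~R) -[i%:R]/(i%:~R) -intrB -intrN; congr (_%:~R); lia.
  rewrite !mulNr -opprD => /eqP; rewrite oppr_eq0 addr_eq0 => /eqP ->.
  have -> : i.+1%:R * ((-1) ^+ i.+1 * 'C(k, i.+1)%:R * Y) =
    - (-1) ^+ i * (i.+1%:R * 'C(k, i.+1)%:R) * Y by rewrite exprS; ring.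
  by rewrite E1; ring.
have := walk k (leqnn k).
by rewrite subrK binn mulr1.
Qed.

(** * Skew-symmetry modulo the image of the translation *)

HB.instance Definition _ (R : realType) (V : lmodType R[i]) (A : vertex_algebra V)
    (x : V) (n : int) :=
  GRing.isLinear.Build R[i] V V *:%R (va_mode A x n) (@va_mode_linearr _ _ A x n).

Section SkewSymmetry.
Context {R : realType} {V : lmodType R[i]} (A : vertex_algebra V).
Context (phi : {scalar V}) (phi_transl : forall v, phi (va_transl A v) = 0).

Lemma vacuum_locality e e' x y : va_parity A e x -> va_parity A e' y ->
  exists N : nat, forall m n : int,
    diffpow N (fun m n => phi (va_mode A x m (va_mode A y n (va_vacuum A)))) m n =
    (-1) ^+ (e && e') *
    diffpow N (fun m n => phi (va_mode A y n (va_mode A x m (va_vacuum A)))) m n.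
Proof.
move=> xe ye; have [N loc] := va_locality xe ye; exists N => m n.
have /(congr1 phi) := loc m n (va_vacuum A).
rewrite linear_sum linear0 => locphi.
apply/eqP; rewrite -subr_eq0 -locphi !diffpowE mulr_sumr -sumrB; apply/eqP.
apply: eq_bigr => j _; rewrite scalarZ linearB scalarZ /=.
by rewrite mulrBr; congr (_ - _); rewrite mulrCA.
Qed.

(** The vacuum being translation invariant, [phi] of the translate of
    [Y(x,z) Y(y,w) |0>] is the image of the correlation series under
    [d/dz + d/dw]. *)
Lemma vacuum_translation_invariant x y (m n : int) :
  m%:~R * phi (va_mode A x (m - 1) (va_mode A y n (va_vacuum A))) +
  n%:~R * phi (va_mode A x m (va_mode A y (n - 1) (va_vacuum A))) = 0.
Proof.
have Ty : va_transl A (va_mode A y n (va_vacuum A)) =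
    - (n%:~R *: va_mode A y (n - 1) (va_vacuum A)).
  by rewrite -va_transl_mode va_transl_vacuum linear0 subr0.
have /(congr1 phi) := va_transl_mode A x m (va_mode A y n (va_vacuum A)).
have modeNZ a u : va_mode A x m (- (a *: u)) = - (a *: va_mode A x m u).
  by rewrite linearN linearZ.
rewrite Ty modeNZ.
rewrite linearB phi_transl !linearN !scalarZ /= sub0r mulrN opprK => ->.
by rewrite addrN.
Qed.

(** The coefficient of [w^0] in the locality relation.  On the side of
    [x_m y_n |0>] creation leaves only the term [phi (x_p y)].  The other side has
    no negative powers of [z], so it is zero for [p >= N]; for [p < N] translation
    invariance carries its coefficient to that of [z^0], which is
    [(-1)^N phi (y_p x)]. *)
Lemma skew_symmetry_or_vanishing e e' x y : va_parity A e x -> va_parity A e' y ->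
  exists N : nat, forall p : int,
    phi (va_mode A x p y) =
    if p < N%:Z then (-1) ^+ (e && e') * (-1) ^ (p + 1) * phi (va_mode A y p x) else 0.
Proof.
move=> xe ye; have [N FG] := vacuum_locality _ _ _ _ xe ye; exists N => p.
set F := fun m n => phi (va_mode A x m (va_mode A y n (va_vacuum A))) in FG.
set G := fun m n => phi (va_mode A y n (va_mode A x m (va_vacuum A))) in FG.
have F0 m n : 0 <= n -> F m n = 0.
  by move=> n0; rewrite /F va_creation_ge0 // !linear0.
have G0 m n : 0 <= m -> G m n = 0.
  by move=> m0; rewrite /G va_creation_ge0 // !linear0.
have Ginv m n : m%:~R * G (m - 1) n + n%:~R * G m (n - 1) = 0.
  by rewrite addrC vacuum_translation_invariant.
have := FG (p - N%:Z) (-1); rewrite (diffpow_edger _ _ _ F0) subrK.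
rewrite {1}/F va_creation => ->.
have [pN | Np] := ltP p N%:Z; last by rewrite diffpow_eq0l ?mulr0 // subr_ge0.
have [k kE] : exists k : nat, k%:Z = N%:Z - 1 - p by exists (absz (N%:Z - 1 - p)%R); lia.
have -> : p - N%:Z = -1 - k%:Z by lia.
rewrite translation_invariant_diagonal; last exact: diffpow_invariant.
rewrite diffpow_edgel // /G va_creation.
have -> : -1 - k%:Z + N%:Z = p by lia.
have -> : (-1) ^ (p + 1) = (-1) ^+ k * (-1) ^+ N :> R[i].
  by rewrite -exprD expN1r -signr_odd -[RHS]signr_odd; congr (_ ^+ nat_of_bool _); lia.
by rewrite !mulrA.
Qed.

Lemma sqr_sign_mul (b : bool) (p : int) :
  ((-1) ^+ b * (-1) ^ p) * ((-1) ^+ b * (-1) ^ p) = 1 :> R[i].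
Proof. by rewrite expN1r -exprD -expr2 sqrr_sign. Qed.

(** The bound in the preceding lemma may differ for the pairs [(x, y)] and
    [(y, x)].  When [p] exceeds only one of them, the relation is read from the
    other pair; when it exceeds both, the two values are zero. *)
Lemma skew_symmetry e e' x y (p : int) : va_parity A e x -> va_parity A e' y ->
  phi (va_mode A x p y) = (-1) ^+ (e && e') * (-1) ^ (p + 1) * phi (va_mode A y p x).
Proof.
move=> xe ye.
have [N xy] := skew_symmetry_or_vanishing _ _ _ _ xe ye.
have [N' yx] := skew_symmetry_or_vanishing _ _ _ _ ye xe.
have := xy p; case: ifP => // _ xy0.
have := yx p; case: ifP => [_ -> | _ ->]; last by rewrite xy0 mulr0.
by rewrite andbC mulrA sqr_sign_mul mul1r.
Qed.
End SkewSymmetry.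

(** * Exchanging L_1 between the two arguments of a mode *)

(** The recurrence is satisfied by [(-1)^{j+k} a k j] as well.  The difference
    [d] of the two solutions is zero at level [j + k = n + 1] once it is at level
    [n]: it then alternates in sign along level [n + 1], which is the opposite of
    the symmetry that [d] has by construction. *)
Lemma sl2_recurrence_symmetric (K : numDomainType) (a : nat -> nat -> K) :
  (forall j k, a j.+1 k + a j k.+1 = (j%:R - k%:R) * a j k) ->
  forall j k, a j k = (-1) ^+ (j + k) * a k j.
Proof.
move=> rec.
pose d j k := a j k - (-1) ^+ (j + k) * a k j.
have dS j k : d j.+1 k = (j%:R - k%:R) * d j k - d j k.+1.
  have := rec j k; have := rec k j; rewrite /d addSn addnS exprS.
  move=> /(canRL (addrK _)) -> /(canRL (addrK _)) ->; ring.
have dN j k : d j k = - (-1) ^+ (j + k) * d k j.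
  by rewrite /d addnC mulrBr !mulNr mulrA -expr2 sqrr_sign; ring.
suff d0 n j k : (j + k = n)%N -> d j k = 0.
  by move=> j k; apply/eqP; rewrite -subr_eq0 -/(d j k) (d0 (j + k)%N).
elim: n j k => [|n IHn] j k.
  by case: j k => [|j] [|k] // _; rewrite /d mul1r subrr.
have shift i : (i <= n.+1)%N -> d i (n.+1 - i)%N = (-1) ^+ i * d 0%N n.+1.
  elim: i => [|i IHi] i_n; first by rewrite mul1r subn0.
  rewrite dS IHn; last lia.
  by rewrite -subSn // subSS IHi ?(ltnW i_n) // exprS; ring.
move=> jk; have <- : (n.+1 - j = k)%N by lia.
rewrite shift; last lia.
suff -> : d 0%N n.+1 = 0 by rewrite mulr0.
have := shift n.+1 (leqnn _); rewrite subnn dN addn0 mulNr => /eqP.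
rewrite -subr_eq0 -opprD oppr_eq0 -mulr2n mulrn_eq0 /= mulf_eq0 signr_eq0 /=.
by move/eqP.
Qed.

Section Moebius.
Context {R : realType} {V : lmodType R[i]} (A : moebius_vertex_algebra V).

Lemma subspaceZ (W : set V) (a : R[i]) (v : V) : is_subspace W -> W v -> W (a *: v).
Proof. by move=> [W0 WD] Wv; rewrite -[_ *: _]addr0; apply: WD. Qed.

(** The weight spaces are the full eigenspaces of L_0, since V is their direct
    sum and distinct weights give distinct eigenvalues. *)
Lemma eigenvector_weight (h : int) (v : V) :
  mva_L A 0 v = (h%:~R / 2) *: v -> mva_weight A h v.
Proof.
have [subW spanW indepW] := mva_weight_sum A.
have [s [f [Wf vE]]] := spanW v I.
(* The spanning sequence may repeat a weight: collect equal indices first. *)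
pose g i := f i *+ count_mem i s.
have Wg i : mva_weight A i (g i) by rewrite /g -scaler_nat; exact: subspaceZ.
have {}vE : v = \sum_(i <- undup s) g i.
  by rewrite vE big_undup_iterop_count.
move=> L0v.
have eig0 : \sum_(i <- undup s) ((i%:~R - h%:~R) / 2) *: g i = 0.
  move: L0v; rewrite {1 2}vE linear_sum scaler_sumr => /eqP.
  rewrite -subr_eq0 -sumrB => /eqP; apply: etrans; apply: eq_bigr => i _.
  by rewrite (mva_L_weight (Wg i)) -scalerBl; congr (_ *: _); rewrite mulrBl.
have g0 i : i \in undup s -> ((i%:~R - h%:~R) / 2) *: g i = 0.
  apply: (indepW _ (fun i => ((i%:~R - h%:~R) / 2) *: g i)) => //.
    exact: undup_uniq.
  by move=> j; apply: subspaceZ.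
rewrite vE big_seq_cond; elim/big_rec: _ => [|i u /andP[is_ _] Wu].
  by case: (subW h).
have [-> | ih] := eqVneq i h; first by rewrite -[g h]scale1r; apply: (subW h).2.
have /eqP := g0 i is_; rewrite scaler_eq0 mulf_eq0 invr_eq0 pnatr_eq0 orbF subr_eq0.
by rewrite eqr_int (negPf ih) => /eqP ->; rewrite add0r.
Qed.

Lemma L1_weight (h : int) (x : V) :
  mva_weight A h x -> mva_weight A (h - 2) (mva_L A 1 x).
Proof.
move=> hx; apply: eigenvector_weight.
have := @mva_L_comm _ _ A 0 1 x isT isT.
rewrite (mva_L_weight hx) linearZ /= => /eqP; rewrite subr_eq => /eqP ->.
by rewrite !add0r -scalerDl; congr (_ *: _); rewrite intrD !intrN; field.
Qed.

Lemma iter_L1_weight (h : int) (x : V) (k : nat) :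
  mva_weight A h x -> mva_weight A (h - 2 * k%:Z) (iter k (mva_L A 1) x).
Proof.
move=> hx; elim: k => [|k IHk]; first by rewrite mulr0 subr0.
by rewrite iterS; have := L1_weight _ _ IHk; congr (mva_weight A _ _); lia.
Qed.

Lemma iter_L1_parity (e : bool) (x : V) (k : nat) :
  va_parity A e x -> va_parity A e (iter k (mva_L A 1) x).
Proof. by move=> ex; elim: k => [//|k IHk]; rewrite iterS; apply: mva_L_even. Qed.

(** L_1 lowers the weight, which is bounded below; the bound is uniform on a
    weight space, so one truncation serves both arguments of the form. *)
Lemma iter_L1_eq0 (h : int) :
  exists N : nat, forall x, mva_weight A h x -> iter N (mva_L A 1) x = 0.
Proof.
have [h0 low] := mva_weight_bounded A.
exists (absz (h - h0)%R + 1)%N => x hx.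
have := iter_L1_weight _ _ (absz (h - h0)%R + 1) hx.
by rewrite low //; lia.
Qed.

Context (phi : {scalar V}) (phi_L1 : forall v, phi (mva_L A 1 v) = 0).

Lemma transl_mode (x u : V) (n : int) :
  va_mode A (mva_L A (-1) x) n u = - (n%:~R *: va_mode A x (n - 1) u).
Proof.
have := @mva_L_mode _ _ A (-1) x n u isT.
rewrite !mva_L_transl va_transl_mode big_ord1 /= => ->.
rewrite scale1r -mva_L_transl.
have -> : n - 1 + 1 - 0%:Z = n by lia.
by [].
Qed.

Lemma modeZl (a : R[i]) (x u : V) (n : int) :
  va_mode A (a *: x) n u = a *: va_mode A x n u.
Proof. exact: (scalable_linear (@va_mode_linearl _ _ A n u)). Qed.

(** [phi] of [L_1 (y_n x)] is zero, so [L_1] moves to [y] at the price of the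
    commutator [[L_1, y_n]]. *)
Lemma move_L1 (h n : int) (x y : V) : mva_weight A h y ->
  phi (va_mode A y n (mva_L A 1 x)) =
  (n + 2 - h)%:~R * phi (va_mode A y (n + 1) x) - phi (va_mode A (mva_L A 1 y) n x).
Proof.
move=> hy; have := @mva_L_mode _ _ A 1 y n x isT.
rewrite !big_ord_recr big_ord0 /= add0r !scale1r.
have -> : 0%:Z - 1 = -1 :> int by [].
have -> : 1%:Z - 1 = 0 :> int by [].
have -> : (1 + 1)%N%:Z - 1 = 1 :> int by [].
rewrite transl_mode (mva_L_weight hy) modeZl scalerA.
have -> : n + 1 + 1 - 0%:Z - 1 = n + 1 by lia.
have -> : n + 1 + 1 - 1%:Z = n + 1 by lia.
have -> : n + 1 + 1 - (1 + 1)%N%:Z = n by lia.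
rewrite -scaleNr -scalerDl => /(congr1 phi).
rewrite linearB !linearD phi_L1 scalarZ /= sub0r => /(canRL (@opprK _)) ->.
rewrite opprD -mulNr; congr (_ * _ - _).
have -> : n + 1 + 1 - 0%:Z = n + 2 by lia.
by rewrite intrB bin1; field.
Qed.

(** With the mode number [h - 1 - j - k] the scalar in [move_L1] becomes [j - k],
    antisymmetric in [j] and [k]; this is why the exchange has no correction. *)
Lemma L1_exchange (h : int) (x y : V) : mva_weight A h y -> forall j k : nat,
  let a j k := phi (va_mode A (iter j (mva_L A 1) y) (h - 1 - j%:Z - k%:Z)
                      (iter k (mva_L A 1) x)) in
  a j k = (-1) ^+ (j + k) * a k j.
Proof.
move=> hy; apply: sl2_recurrence_symmetric => j k.
rewrite iterS [X in _ + X](move_L1 (h - 2 * j%:Z)); last exact: iter_L1_weight.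
rewrite addrC -iterS.
have -> : h - 1 - j%:Z - k.+1%:Z + 1 = h - 1 - j%:Z - k%:Z by lia.
have -> : h - 1 - j.+1%:Z - k%:Z = h - 1 - j%:Z - k.+1%:Z by lia.
rewrite subrK; congr (_ * _).
by rewrite -[j%:R]/(j%:~R) -[k%:R]/(k%:~R) -intrB; congr (_%:~R); lia.
Qed.
End Moebius.

(** * Symmetry of an invariant form *)

Section FormSymmetry.
Context {R : realType} {V : lmodType R[i]} (A : moebius_vertex_algebra V).
Context (B : V -> V -> R[i]) (bilB : bilinear_form B) (invB : invariant_form A B).

Lemma invariant_form_symmetric (h : int) (e e' : bool) (x y : V) :
  mva_weight A h x -> mva_weight A h y -> va_parity A e x -> va_parity A e' y ->
  B x y = (-1) ^+ (e && e') * (-1) ^ h * B y x.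
Proof.
move=> hx hy ex ey.
pose phi0 := B (va_vacuum A).
pose phi : {scalar V} :=
  HB.pack phi0 (GRing.isLinear.Build R[i] V R[i] *%R phi0 (bilB.2 _)).
have [invY invL] := invB.
have B0 v : B 0 v = 0.
  by have := scalable_linear (bilB.1 v) 0 0; rewrite scale0r /= mul0r.
have phi_Lm1 v : phi (mva_L A (-1) v) = 0.
  by have := invL 1 (va_vacuum A) v isT; rewrite mva_L_vacuum // B0.
have phi_L1 v : phi (mva_L A 1 v) = 0.
  by have := invL (-1) (va_vacuum A) v isT; rewrite mva_L_vacuum // B0.
have [N L1N] := iter_L1_eq0 A h.
(* Invariance applied to [u = u_{-1} |0>]; there is no sign, the vacuum being even. *)
have expand u v c : mva_weight A h u -> va_parity A c u ->
    B u v = 'i ^ h * \sum_(k < N) (k`!%:R)^-1 *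
      phi (va_mode A (iter k (mva_L A 1) u) (h - 1 - k%:Z) v).
  move=> hu cu; rewrite -{1}[u](va_creation A).
  rewrite (invY h c false _ _ _ _ N hu cu (va_vacuum_even A) (L1N _ hu)).
  rewrite andbF mul1r -/phi0 -[phi0]/(phi : V -> R[i]) /adjoint_mode.
  rewrite (scalarZ phi) linear_sum; congr (_ * _); apply: eq_bigr => k _.
  by rewrite (scalarZ phi); congr (_ * phi (va_mode A _ _ _)); lia.
rewrite (expand x y e) // (expand y x e') // mulrCA; congr (_ * _).
rewrite mulr_sumr; apply: eq_bigr => k _; rewrite mulrCA; congr (_ * _).
have phi_transl v : phi (va_transl A v) = 0 by rewrite -mva_L_transl.
have ekx := iter_L1_parity _ _ _ k ex.
rewrite (skew_symmetry _ _ phi_transl _ _ _ _ _ ekx ey).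
have := L1_exchange _ _ phi_L1 _ x _ hy k 0.
rewrite /= !subr0 addn0 => ->.
rewrite !mulrA; congr (_ * _).
rewrite -mulrA; congr (_ * _).
rewrite !expN1r -exprD -signr_odd -[RHS]signr_odd; congr (_ ^+ nat_of_bool _); lia.
Qed.
End FormSymmetry.

(** * Positivity *)

Section GradedUnitary.
Context {R : realType} {V : lmodType R[i]} (A : weak_graded_unitary V).

Lemma rho0 : wgu_rho A 0 = 0.
Proof.
have := wgu_rho_antilinear A 1 0 0; rewrite scaler0 addr0 rmorph1 scale1r.
by move/eqP; rewrite -subr_eq subrr eq_sym => /eqP.
Qed.

Lemma rhoZ (a : R[i]) (x : V) : wgu_rho A (a *: x) = a^* *: wgu_rho A x.
Proof.
by have := wgu_rho_antilinear A a x 0; rewrite rho0 !addr0.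
Qed.

Lemma rho_weight (h : int) (x : V) : mva_weight A h x -> mva_weight A h (wgu_rho A x).
Proof.
move=> hx; apply: eigenvector_weight; rewrite -wgu_rho_L // (mva_L_weight hx) rhoZ.
by rewrite rmorphM fmorphV rmorph_int rmorph_nat.
Qed.

(** From [rho sigma = sigma^-1 rho], since the conjugate of [i^r] is its inverse. *)
Lemma sigma_rho (r : int) (x : V) : wgu_sigma A x = 'i ^ r *: x ->
  wgu_sigma A (wgu_rho A x) = 'i ^ r *: wgu_rho A x.
Proof.
move=> sx; rewrite -[X in _ *: X](wgu_sigmaVK A) -wgu_rho_sigma sx rhoZ.
rewrite [wgu_sigma A (_ *: _)]linearZ scalerA.
by rewrite fmorphXz /= conjCi -expfzMl mulrN -expr2 sqrCi opprK exp1rz scale1r.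
Qed.

End GradedUnitary.

Theorem proposition2p29 (R : realType) (V : lmodType R[i])
    (A : weak_graded_unitary V) (h2 r2 : int) (e : bool) (x : V) :
  x <> 0 -> va_parity A e x -> wgu_bigraded A h2 r2 x ->
  (-1) ^+ e = (-1) ^ (h2 + r2) :> R[i].
Proof.
move=> /eqP x0 ex rx; have [hx _ _] := rx.
have sx := wgu_sigma_bigraded rx.
have srx := sigma_rho _ _ _ sx.
have pos : 0 < wgu_form A (wgu_sigma A (wgu_rho A x)) x.
  by have [_ _ _] := wgu_positive A; apply.
have rx0 : wgu_rho A x != 0.
  by rewrite -(rho0 A) (inj_eq (bij_inj (wgu_rho_bijective A))).
have posr : 0 < wgu_form A (wgu_sigma A (wgu_rho A (wgu_rho A x))) (wgu_rho A x).
  by have [_ _ _] := wgu_positive A; apply.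
have [formZ _] := wgu_form_bilinear A.
have formZl a u v : wgu_form A (a *: u) v = a * wgu_form A u v.
  exact: (scalable_linear (formZ v)).
have sZ a u : wgu_sigma A (a *: u) = a *: wgu_sigma A u by exact: linearZ.
move: posr; rewrite wgu_rho_square !(sx, sZ) !formZl.
rewrite (invariant_form_symmetric A _ (wgu_form_bilinear A) (wgu_form_invariant A)
  h2 e e x (wgu_rho A x)) //; first last.
- exact: wgu_rho_parity.
- exact: rho_weight.
move: pos; rewrite srx formZl andbb; set t := wgu_form A _ _ => pos.
have i2 : 'i ^ r2 * 'i ^ r2 = (-1) ^ r2 :> R[i] by rewrite -expfzMl -expr2 sqrCi.
have -> : 'i ^ r2 * ('i ^ r2 * ('i ^ r2 * ((-1) ^+ e * (-1) ^ h2 * t))) =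
    ((-1) ^ r2 * (-1) ^+ e * (-1) ^ h2) * ('i ^ r2 * t) by rewrite -i2; ring.
rewrite pmulr_lgt0 // !expN1r -!exprD => sgn.
have ev : ~~ odd (absz r2 + e + absz h2).
  by apply: contraL sgn => odd_sgn; rewrite -signr_odd odd_sgn oppr_gt0 ltr10.
by rewrite -[RHS]signr_odd; congr (_ ^+ nat_of_bool _); lia.
Qed.
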